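(* Consider the single-mode stochastic hybrid system with state $(b,x)\in\mathbb{R}^{N+n}$ given by the continuous dynamics $$d\begin{bmatrix} b\\ x\end{bmatrix}=\begin{bmatrix}0\\ \sum_{i=1}^N b_i f(s_i,x)\end{bmatrix}dt+\begin{bmatrix}0\\ \sum_{i=1}^N b_i g(s_i,x)\,dw\end{bmatrix},$$ reset intensities $\sum_{i=1}^N b_i\lambda_r(s_i,x)$, $r=1,\dots,\mathcal{R}$, and reset maps $$(b,x)\mapsto\Big(b-\sum_{i=1}^N b_i\,e_{s_i}+\sum_{i=1}^N b_i\,e_{\theta_r(s_i)},\ \sum_{i=1}^N b_i\,\phi_r(s_i,x)\Big),\qquad r=1,\dots,\mathcal{R}.$$ Let $f$, $g$, $\lambda_r$ and $\phi_r$ be polynomials in $x$ (for each given discrete state). Denote by $\mathcal{X}$ the vector consisting of all moments of the state $(b,x)$ up to a specific order. Then its time evolution can be compactly written as $$\frac{d\mathcal{X}}{dt}=A\mathcal{X}+B\bar{\mathcal{X}},\qquad 0=C\mathcal{X}+D\bar{\mathcal{X}}$$ for appropriately defined matrices $A$, $B$, $C$, $D$. Here $\bar{\mathcal{X}}$ is a collection of moments of $(b,x)$ whose order is higher than those stacked up in $\mathcal{X}$.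
   Context: $Q=\{s_1,\dots,s_N\}$ is a finite set of discrete states (modes); $f:Q\times\mathbb{R}^n\to\mathbb{R}^n$, $g:Q\times\mathbb{R}^n\to\mathbb{R}^{n\times k}$, $\lambda_r:Q\times\mathbb{R}^n\to[0,\infty)$, $\theta_r:Q\to Q$, $\phi_r:Q\times\mathbb{R}^n\to\mathbb{R}^n$ for $r=1,\dots,\mathcal{R}$; $w$ is a $k$-dimensional Wiener process. For $s_i\in Q$, $e_{s_i}\in\mathbb{R}^N$ is the vector with $1$ in position $i$ and zeros elsewhere. The vector $b=(b_1,\dots,b_N)$ is the indicator of the current discrete state: $b_i=1$ if the discrete state is $s_i$, and $b_i=0$ otherwise; consequently $\sum_{i=1}^N b_i=1$, $b_ib_j=0$ for $i\neq j$, and $b_i^2=b_i$. The state follows the stochastic differential equation between resets; reset $r$ occurs with the stated state-dependent intensity and changes the state by the stated reset map. A moment of $(b,x)$ is an expectation $\mathbb{E}(b_1^{m_1}\cdots b_N^{m_N}x_1^{m_{N+1}}\cdots x_n^{m_{N+n}})$ with $m\in\mathbb{N}^{N+n}$, where $\mathbb{N}$ is the set of non-negative integers; its order is $\sum_i m_i$. The zeroth-order moment $\mathbb{E}(1)=1$ is included in $\mathcal{X}$. Standing convention: the moments are finite and evolve by the extended generator. That is, for a single-mode stochastic hybrid system with state $z$, drift $F(z)$, diffusion coefficient $G(z)$, intensities $\Lambda_r(z)\ge 0$ and reset maps $z\mapsto\Phi_r(z)$, and for monomial test functions $\psi$, one has $\frac{d}{dt}\mathbb{E}[\psi(z)]=\mathbb{E}[(\mathcal{L}\psi)(z)]$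 with $$(\mathcal{L}\psi)(z)=\frac{\partial\psi}{\partial z}F(z)+\tfrac12\operatorname{Trace}\Big(\frac{\partial^2\psi}{\partial z^2}G(z)G(z)^\top\Big)+\sum_{r=1}^{\mathcal{R}}\big(\psi(\Phi_r(z))-\psi(z)\big)\Lambda_r(z).$$ *)

(* Defs.v *)
From HB Require Import structures.
From mathcomp Require Import all_boot all_order all_algebra.
From mathcomp Require Import all_classical all_reals all_analysis.
(* the notations of mpoly clash with those of MathComp-Analysis *)
From mathcomp Require Import -(notations) mpoly.

Set Implicit Arguments.
Unset Strict Implicit.
Unset Printing Implicit Defensive.

Import Order.TTheory GRing.Theory Num.Theory.
Import numFieldNormedType.Exports.

Local Open Scope classical_set_scope.
Local Open Scope ring_scope.

Notation "{ 'mpoly' R [ n ] }" := (mpoly n R)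
  (at level 0, R at level 200, n at level 2, format "{ 'mpoly'  R [ n ] }")
  : type_scope.

Section Polynomial.
Context {R : realType}.

Definition poly_fun n (h : 'cV[R]_n -> R) : Prop :=
  exists p : {mpoly R[n]}, forall x, h x = meval (fun j => x j 0) p.

Definition poly_mx_fun n a c (h : 'cV[R]_n -> 'M[R]_(a, c)) : Prop :=
  forall i j, poly_fun (fun x => h x i j).

Definition monomial d (m : multinom d) (z : 'cV[R]_d) : R :=
  \prod_(i < d) z i 0 ^+ m i.

End Polynomial.

Section Generator.
Context {R : realType}.

Definition gradient d (psi : 'cV[R]_d -> R) (z : 'cV[R]_d) : 'rV[R]_d :=
  \row_i 'D_(delta_mx i 0) psi z.

Definition hessian d (psi : 'cV[R]_d -> R) (z : 'cV[R]_d) : 'M[R]_d :=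
  \matrix_(i, j) 'D_(delta_mx i 0) ('D_(delta_mx j 0) psi) z.

Definition generator d k r (F : 'cV[R]_d -> 'cV[R]_d)
    (G : 'cV[R]_d -> 'M[R]_(d, k)) (Lambda : 'I_r -> 'cV[R]_d -> R)
    (Phi : 'I_r -> 'cV[R]_d -> 'cV[R]_d)
    (psi : 'cV[R]_d -> R) (z : 'cV[R]_d) : R :=
  (gradient psi z *m F z) 0 0
  + 2^-1 * \tr (hessian psi z *m (G z *m (G z)^T))
  + \sum_(l < r) (psi (Phi l z) - psi z) * Lambda l z.

End Generator.

Section Moments.
Context {R : realType} {disp : measure_display} {T : measurableType disp}.
Variable P : probability T R.

(* Derivative at t of a function of time t >= 0; one-sided at t = 0. *)
Definition has_time_derivative (u : R -> R) (t l : R) : Prop :=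
  (fun s => (u s - u t) / (s - t)) @ within `[0, +oo[ t^' --> l.

(* [fine] is harmless: it is only used under [finite_moments] below. *)
Definition moment d (Z : T -> 'cV[R]_d) (m : multinom d) : R :=
  fine 'E_P[fun w => monomial m (Z w)].

Definition moment_vector d (Z : T -> 'cV[R]_d) (ms : seq (multinom d)) :
    'cV[R]_(size ms) :=
  \col_i moment Z (tnth (in_tuple ms) i).

Definition finite_moments d (Z : T -> 'cV[R]_d) : Prop :=
  forall m : multinom d,
    P.-integrable setT (fun w => (monomial m (Z w))%:E).

Definition moments_evolve_by_generator d k r (F : 'cV[R]_d -> 'cV[R]_d)
    (G : 'cV[R]_d -> 'M[R]_(d, k)) (Lambda : 'I_r -> 'cV[R]_d -> R)
    (Phi : 'I_r -> 'cV[R]_d -> 'cV[R]_d) (Z : R -> T -> 'cV[R]_d) : Prop :=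
  forall t, 0 <= t ->
    finite_moments (Z t) /\
    forall m : multinom d,
      has_time_derivative (fun s => moment (Z s) m) t
        (fine 'E_P[fun w => generator F G Lambda Phi (monomial m) (Z t w)]).

End Moments.

(* The modes s_1, ..., s_N are the elements of 'I_N; a state of the
   single-mode system is z = col_mx b x, so that b_i = usubmx z i 0. *)
Section SingleMode.
Context {R : realType} {N n : nat}.

Definition mode_vector (i : 'I_N) : 'cV[R]_N := delta_mx i 0.

Definition joint_state (i : 'I_N) (x : 'cV[R]_n) : 'cV[R]_(N + n) :=
  col_mx (mode_vector i) x.

Definition sm_drift (f : 'I_N -> 'cV[R]_n -> 'cV[R]_n) (z : 'cV[R]_(N + n)) :
    'cV[R]_(N + n) :=
  col_mx 0 (\sum_(i < N) usubmx z i 0 *: f i (dsubmx z)).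

Definition sm_diffusion k (g : 'I_N -> 'cV[R]_n -> 'M[R]_(n, k))
    (z : 'cV[R]_(N + n)) : 'M[R]_(N + n, k) :=
  col_mx 0 (\sum_(i < N) usubmx z i 0 *: g i (dsubmx z)).

Definition sm_intensity r (lambda : 'I_r -> 'I_N -> 'cV[R]_n -> R)
    (l : 'I_r) (z : 'cV[R]_(N + n)) : R :=
  \sum_(i < N) usubmx z i 0 * lambda l i (dsubmx z).

Definition sm_reset r (theta : 'I_r -> 'I_N -> 'I_N)
    (phi : 'I_r -> 'I_N -> 'cV[R]_n -> 'cV[R]_n)
    (l : 'I_r) (z : 'cV[R]_(N + n)) : 'cV[R]_(N + n) :=
  col_mx (usubmx z - \sum_(i < N) usubmx z i 0 *: mode_vector i
                   + \sum_(i < N) usubmx z i 0 *: mode_vector (theta l i))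
         (\sum_(i < N) usubmx z i 0 *: phi l i (dsubmx z)).

Definition bvar (i : 'I_N) : {mpoly R[N + n]} := mpolyX R (mnm1 (lshift n i)).

(* [mode_identity p]: p = 0 is one of the identities satisfied by b. *)
Inductive mode_identity : {mpoly R[N + n]} -> Prop :=
| mode_sum : mode_identity (\sum_(i < N) bvar i - 1)
| mode_orthogonal (i j : 'I_N) : i != j -> mode_identity (bvar i * bvar j)
| mode_idempotent (i : 'I_N) : mode_identity (bvar i ^+ 2 - bvar i).

(* [algebraic_relation ms p]: p is a mode identity times a monomial, and every
   monomial of p belongs to ms.  Taking expectations in p = 0 then gives a
   linear equation between the moments listed in ms. *)
Definition algebraic_relation (ms : seq (multinom (N + n)))
    (p : {mpoly R[N + n]}) : Prop :=
  (exists2 q, mode_identity q & exists mu, p = q * mpolyX R mu) /\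
  {subset msupp p <= ms}.

Definition coeff_row d (p : {mpoly R[d]}) (ms : seq (multinom d)) :
    'rV[R]_(size ms) :=
  \row_j mcoeff (tnth (in_tuple ms) j) p.

(* The rows of (C D) are exactly the coefficient rows of the relations among
   the listed moments that are inherited from the mode identities. *)
Definition encodes_mode_identities (X Xbar : seq (multinom (N + n))) c
    (C : 'M[R]_(c, size X)) (D : 'M[R]_(c, size Xbar)) : Prop :=
  (forall l : 'I_c, exists2 p, algebraic_relation (X ++ Xbar) p &
     row l C = coeff_row p X /\ row l D = coeff_row p Xbar) /\
  (forall p, algebraic_relation (X ++ Xbar) p -> exists l : 'I_c,
     row l C = coeff_row p X /\ row l D = coeff_row p Xbar).

End SingleMode.

(* Main.v *)
Require Import Defs.
From HB Require Import structures.
From mathcomp Require Import all_boot all_order all_algebra.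
From mathcomp Require Import all_classical all_reals all_analysis.
From mathcomp Require Import -(notations) mpoly.
Import Order.TTheory GRing.Theory Num.Theory.
Import numFieldNormedType.Exports.
Local Open Scope classical_set_scope.
Local Open Scope ring_scope.

(** The generator maps polynomials to polynomials.  For every mode the data of
    the system are polynomials in [x], and the single-mode dynamics combines
    them linearly with the coordinates [b_i], so drift, diffusion, intensities
    and reset maps are polynomials in [z = (b, x)].  Derivatives of a monomial
    are polynomials ([is_derive_meval]), and so is its composition with a reset
    map; hence the generator applied to a monomial [m] is evaluation of some
    polynomial [L m] ([poly_fun_generator], [poly_fun_sm_generator]).

    The expectation of a polynomial of [Z t] is the combination of moments given
    by its coefficients ([expectation_meval]).  Therefore the derivative of the
    moment [m] is a linear combination of the moments in the support of [L m].
    Let [Xbar] collect the monomials of degree above [M] in the supports of the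
    [L m], for [m] in [X]; the coefficients of the [L m] on [X] and on [Xbar]
    are the rows of [A] and [B].

    For the algebraic equations, a mode identity vanishes at every state whose
    [b] part is an indicator vector ([mode_identity_joint_state]), and so do its
    multiples by monomials.  Taking expectations gives one linear equation for
    each relation supported in [X ++ Xbar].  These relations are finite in
    number ([finite_algebraic_relation]), so their coefficients can be listed as
    the rows of [C] and [D]. *)

Set Implicit Arguments.
Unset Strict Implicit.
Unset Printing Implicit Defensive.

(** * Polynomial functions *)

Section PolynomialFunctions.
Context {R : realType} {d : nat}.
Implicit Types (h : 'cV[R]_d -> R) (p : {mpoly R[d]}) (m : multinom d).

Lemma monomialE m :
  monomial m = fun z : 'cV[R]_d => meval (fun j => z j 0) (mpolyX R m).
Proof. by apply/funext => z; rewrite mevalX. Qed.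

Lemma poly_fun_cst (c : R) : poly_fun (fun _ : 'cV[R]_d => c).
Proof. by exists (mpolyC d c) => x; rewrite mevalC. Qed.

Lemma poly_fun_coord (i : 'I_d) : poly_fun (fun x : 'cV[R]_d => x i 0).
Proof. by exists (mpolyX R (mnm1 i)) => x; rewrite mevalXU. Qed.

Lemma poly_funD h1 h2 :
  poly_fun h1 -> poly_fun h2 -> poly_fun (fun x => h1 x + h2 x).
Proof. by move=> [p Ep] [q Eq]; exists (p + q) => x; rewrite mevalD Ep Eq. Qed.

Lemma poly_funM h1 h2 :
  poly_fun h1 -> poly_fun h2 -> poly_fun (fun x => h1 x * h2 x).
Proof. by move=> [p Ep] [q Eq]; exists (p * q) => x; rewrite mevalM Ep Eq. Qed.

Lemma poly_funB h1 h2 :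
  poly_fun h1 -> poly_fun h2 -> poly_fun (fun x => h1 x - h2 x).
Proof. by move=> [p Ep] [q Eq]; exists (p - q) => x; rewrite mevalB Ep Eq. Qed.

Lemma poly_funX h e : poly_fun h -> poly_fun (fun x => h x ^+ e).
Proof. by move=> [p Ep]; exists (p ^+ e) => x; rewrite rmorphXn /= Ep. Qed.

Lemma poly_fun_sum (I : Type) (s : seq I) (h : I -> 'cV[R]_d -> R) :
  (forall i, poly_fun (h i)) -> poly_fun (fun x => \sum_(i <- s) h i x).
Proof.
move=> /choice[p Ep]; exists (\sum_(i <- s) p i) => x.
by rewrite raddf_sum; apply: eq_bigr.
Qed.

Lemma poly_fun_prod (I : Type) (s : seq I) (h : I -> 'cV[R]_d -> R) :
  (forall i, poly_fun (h i)) -> poly_fun (fun x => \prod_(i <- s) h i x).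
Proof.
move=> /choice[p Ep]; exists (\prod_(i <- s) p i) => x.
by rewrite rmorph_prod; apply: eq_bigr.
Qed.

Lemma poly_fun_comp e (k : 'cV[R]_e -> R) (u : 'cV[R]_d -> 'cV[R]_e) :
  poly_fun k -> poly_mx_fun u -> poly_fun (fun x => k (u x)).
Proof.
move=> [p Ep] up; under [X in poly_fun X]eq_fun do rewrite Ep mevalE.
apply: poly_fun_sum => m; apply: poly_funM; first exact: poly_fun_cst.
by apply: poly_fun_prod => i; apply: poly_funX; apply: up.
Qed.

Lemma poly_mx_funD a c (u v : 'cV[R]_d -> 'M[R]_(a, c)) :
  poly_mx_fun u -> poly_mx_fun v -> poly_mx_fun (fun x => u x + v x).
Proof.
move=> up vp i j; under [X in poly_fun X]eq_fun do rewrite mxE.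
exact: poly_funD.
Qed.

Lemma poly_mx_funB a c (u v : 'cV[R]_d -> 'M[R]_(a, c)) :
  poly_mx_fun u -> poly_mx_fun v -> poly_mx_fun (fun x => u x - v x).
Proof.
move=> up vp i j; under [X in poly_fun X]eq_fun do rewrite !mxE.
exact: poly_funB.
Qed.

Lemma poly_mx_fun_cst a c (A : 'M[R]_(a, c)) :
  poly_mx_fun (fun _ : 'cV[R]_d => A).
Proof. by move=> i j; apply: poly_fun_cst. Qed.

Lemma poly_mx_funZ a c h (u : 'cV[R]_d -> 'M[R]_(a, c)) :
  poly_fun h -> poly_mx_fun u -> poly_mx_fun (fun x => h x *: u x).
Proof.
move=> hp up i j; under [X in poly_fun X]eq_fun do rewrite mxE.
exact: poly_funM.
Qed.

Lemma poly_mx_fun_sum a c (I : Type) (s : seq I)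
    (u : I -> 'cV[R]_d -> 'M[R]_(a, c)) :
  (forall i, poly_mx_fun (u i)) -> poly_mx_fun (fun x => \sum_(i <- s) u i x).
Proof.
move=> up i j; under [X in poly_fun X]eq_fun do rewrite summxE.
by apply: poly_fun_sum => l; apply: up.
Qed.

Lemma poly_mx_funM a b c (u : 'cV[R]_d -> 'M[R]_(a, b))
    (v : 'cV[R]_d -> 'M[R]_(b, c)) :
  poly_mx_fun u -> poly_mx_fun v -> poly_mx_fun (fun x => u x *m v x).
Proof.
move=> up vp i j; under [X in poly_fun X]eq_fun do rewrite mxE.
by apply: poly_fun_sum => l; apply: poly_funM.
Qed.

Lemma poly_mx_fun_tr a c (u : 'cV[R]_d -> 'M[R]_(a, c)) :
  poly_mx_fun u -> poly_mx_fun (fun x => (u x)^T).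
Proof.
by move=> up i j; under [X in poly_fun X]eq_fun do rewrite mxE; apply: up.
Qed.

Lemma poly_mx_fun_comp e a c (u : 'cV[R]_e -> 'M[R]_(a, c))
    (v : 'cV[R]_d -> 'cV[R]_e) :
  poly_mx_fun u -> poly_mx_fun v -> poly_mx_fun (fun x => u (v x)).
Proof. by move=> up vp i j; apply: poly_fun_comp (up i j) vp. Qed.

Lemma poly_mx_fun_col a b c (u : 'cV[R]_d -> 'M[R]_(a, c))
    (v : 'cV[R]_d -> 'M[R]_(b, c)) :
  poly_mx_fun u -> poly_mx_fun v -> poly_mx_fun (fun x => col_mx (u x) (v x)).
Proof.
move=> up vp i j; case: (split_ordP i) => l ->.
  by under [X in poly_fun X]eq_fun do rewrite col_mxEu; apply: up.
by under [X in poly_fun X]eq_fun do rewrite col_mxEd; apply: vp.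
Qed.

(** A coordinate is an entry of the identity map, whose derivative in a
    direction is that direction. *)
Lemma is_derive_coord (i j : 'I_d) (z : 'cV[R]_d) :
  is_derive z (delta_mx i 0) (fun x : 'cV[R]_d => x j 0) (j == i)%:R.
Proof.
have did : derivable (@id 'cV[R]_d) z (delta_mx i 0) by apply: derivable_id.
apply: DeriveDef; first by have /derivable_mxP := did; apply.
have /matrixP/(_ j 0) := derive_mx did.
by rewrite derive_id !mxE andbT => ->.
Qed.

(** Analytic and formal partial derivatives agree: both obey the Leibniz rule
    and agree on constants and variables, which generate all polynomials. *)
Lemma is_derive_meval (i : 'I_d) p (z : 'cV[R]_d) :
  is_derive z (delta_mx i 0) (fun x : 'cV[R]_d => meval (fun j => x j 0) p)
    (meval (fun j => z j 0) (mderiv i p)).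
Proof.
pose der p := is_derive z (delta_mx i 0)
  (fun x : 'cV[R]_d => meval (fun j => x j 0) p)
  (meval (fun j => z j 0) (mderiv i p)).
rewrite -/(der p).
have derC c : der (mpolyC d c).
  rewrite /der mderivC meval0.
  under [X in is_derive _ _ X]eq_fun do rewrite mevalC.
  exact: is_derive_cst.
have derD p1 p2 : der p1 -> der p2 -> der (p1 + p2).
  move=> d1 d2; rewrite /der mderivD mevalD.
  under [X in is_derive _ _ X]eq_fun do rewrite mevalD.
  exact: is_deriveD.
have derM p1 p2 : der p1 -> der p2 -> der (p1 * p2).
  move=> d1 d2; rewrite /der mderivM mevalD !mevalM.
  under [X in is_derive _ _ X]eq_fun do rewrite mevalM.
  apply: is_derive_eq (is_deriveM d1 d2) _.
  by rewrite addrC /GRing.scale /= mulrC.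
have derX j : der (mpolyX R (mnm1 j)).
  rewrite /der mderivX mevalZ mnm1E.
  under [X in is_derive _ _ X]eq_fun do rewrite mevalXU.
  apply: is_derive_eq (is_derive_coord _ _ _) _.
  case: eqP => [->|_]; last by rewrite mul0r.
  by rewrite -{1}[mnm1 i]add0m addmK mpolyX0 meval1 mulr1.
elim/mpolyind: p => [|c m p _ _ dp]; first by rewrite -(mpolyC0 d R).
apply: derD dp; rewrite -mul_mpolyC; apply: (derM); first exact: derC.
rewrite mpolyXE_id; elim/big_ind: _ => [||j _]; [|exact: (derM)|].
  by rewrite -mpolyC1; apply: (derC).
elim: (m j) => [|e IH]; first by rewrite expr0 -mpolyC1; apply: (derC).
by rewrite exprS; apply: derM.
Qed.

Lemma poly_mx_fun_gradient m :
  poly_mx_fun (gradient (@monomial R d m)).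
Proof.
move=> i j; exists (mderiv j (mpolyX R m)) => z; rewrite mxE monomialE.
exact: (@derive_val _ _ _ _ _ _ _ (is_derive_meval j _ z)).
Qed.

Lemma poly_mx_fun_hessian m :
  poly_mx_fun (hessian (@monomial R d m)).
Proof.
move=> i j; exists (mderiv i (mderiv j (mpolyX R m))) => z; rewrite mxE.
have -> : 'D_(delta_mx j 0) (monomial m) =
    fun z : 'cV[R]_d => meval (fun l => z l 0) (mderiv j (mpolyX R m)).
  apply/funext => y; rewrite monomialE.
  exact: (@derive_val _ _ _ _ _ _ _ (is_derive_meval j _ y)).
exact: (@derive_val _ _ _ _ _ _ _ (is_derive_meval i _ z)).
Qed.

(** The three terms of the generator involve only sums, products, formal
    derivatives and composition with [Phi l], all of which preserve
    polynomials. *)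
Lemma poly_fun_generator k r (F : 'cV[R]_d -> 'cV[R]_d)
    (G : 'cV[R]_d -> 'M[R]_(d, k)) (Lambda : 'I_r -> 'cV[R]_d -> R)
    (Phi : 'I_r -> 'cV[R]_d -> 'cV[R]_d) m :
  poly_mx_fun F -> poly_mx_fun G -> (forall l, poly_fun (Lambda l)) ->
  (forall l, poly_mx_fun (Phi l)) ->
  poly_fun (generator F G Lambda Phi (monomial m)).
Proof.
move=> Fp Gp Lp Pp.
have mp : poly_fun (@monomial R d m).
  by exists (mpolyX R m) => z; rewrite monomialE.
apply: poly_funD; first apply: poly_funD.
- exact: (poly_mx_funM (poly_mx_fun_gradient m) Fp).
- apply: poly_funM; first exact: poly_fun_cst.
  apply: poly_fun_sum => i.
  apply: (poly_mx_funM (poly_mx_fun_hessian m) _ i i).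
  by apply: poly_mx_funM => //; apply: poly_mx_fun_tr.
- apply: poly_fun_sum => l; apply: poly_funM => //.
  by apply: poly_funB => //; apply: poly_fun_comp.
Qed.

End PolynomialFunctions.

(** * Expectations of polynomials *)

Section MomentEquations.
Context {R : realType} {d : nat}.
Implicit Types (p : {mpoly R[d]}) (ms : seq (multinom d)).

(** Enlarging the support to [ms] only adds terms with zero coefficient; a
    single list can thus serve for several polynomials. *)
Lemma meval_sum_monomial ms p (z : 'cV[R]_d) :
  uniq ms -> {subset msupp p <= ms} ->
  meval (fun j => z j 0) p = \sum_(m <- ms) mcoeff m p * monomial m z.
Proof.
move=> Ums sub; rewrite mevalE [RHS](bigID (mem (msupp p))) /=.
rewrite [X in _ + X]big1 ?addr0 => [|m]; last first.
  by rewrite -mcoeff_eq0 => /eqP ->; rewrite mul0r.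
rewrite -[RHS]big_filter; apply: perm_big; apply: uniq_perm.
- exact: msupp_uniq.
- exact: filter_uniq.
- by move=> m; rewrite mem_filter; case: (boolP (m \in msupp p)) => // /sub ->.
Qed.

Context {disp : measure_display} {T : measurableType disp}.
Variable P : probability T R.

Lemma coeff_rows_moment_vector (Z : T -> 'cV[R]_d) ms c
    (p : 'I_c -> {mpoly R[d]}) (i : 'I_c) :
  ((\matrix_l coeff_row (p l) ms) *m moment_vector P Z ms) i 0 =
  \sum_(m <- ms) mcoeff m (p i) * moment P Z m.
Proof. by rewrite mxE [RHS]big_tnth; apply: eq_bigr => j _; rewrite !mxE. Qed.

(** Linearity of expectation; finiteness of every moment is what allows the sum
    to be taken out of the integral. *)
Lemma expectation_meval (Z : T -> 'cV[R]_d) ms p :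
  finite_moments P Z -> uniq ms -> {subset msupp p <= ms} ->
  fine 'E_P[fun w => meval (fun j => Z w j 0) p] =
  \sum_(m <- ms) mcoeff m p * moment P Z m.
Proof.
move=> Zfin Ums sub.
under [X in 'E_P[X]%E]eq_fun do rewrite (meval_sum_monomial _ Ums sub).
rewrite unlock; under eq_integral do rewrite -sumEFin.
rewrite integral_sum//=; last first.
  by move=> m; under eq_fun do rewrite EFinM; apply: integrableZl.
have fin m : (\int[P]_w (monomial m (Z w))%:E)%E \is a fin_num.
  exact: integrable_fin_num.
rewrite -sum_fine => [|m _]; last first.
  by under eq_integral do rewrite EFinM; rewrite integralZl// fin_numM.
apply: eq_bigr => m _; under eq_integral do rewrite EFinM.
by rewrite integralZl// fineM// /moment unlock.
Qed.

End MomentEquations.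

(** * Relations among moments *)

Section ModeIdentities.
Context {R : realType} {N n : nat}.

Lemma mode_identity_joint_state (q : {mpoly R[N + n]}) (i : 'I_N)
    (x : 'cV[R]_n) :
  mode_identity q -> meval (fun j => joint_state i x j 0) q = 0.
Proof.
have bE j : meval (fun l => joint_state i x l 0) (bvar j) = (j == i)%:R.
  by rewrite mevalXU col_mxEu mxE andbT.
case=> [|j l jl|j].
- rewrite mevalB raddf_sum /= meval1 (bigD1 i) //= bE eqxx big1 ?addr0 ?subrr//.
  by move=> j /negPf ji; rewrite bE ji.
- rewrite mevalM !bE; case: eqP => [ji|]; last by rewrite mul0r.
  by rewrite -ji eq_sym (negPf jl) mulr0.
- rewrite mevalB rmorphXn /= bE.
  by case: (j == i); rewrite ?expr1n ?expr0n subrr.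
Qed.

(** Each kind of identity fails at a constant point: all coordinates equal to
    0, 1 and 2 respectively. *)
Lemma mode_identity_neq0 (q : {mpoly R[N + n]}) : mode_identity q -> q != 0.
Proof.
have nz c (s : {mpoly R[N + n]}) : meval (fun=> c) s != 0 -> s != 0.
  by apply: contra_neq => ->; rewrite meval0.
case=> [|j l jl|j].
- apply: (nz 0); rewrite mevalB raddf_sum /= meval1 big1 => [|j _].
    by rewrite sub0r oppr_eq0 oner_eq0.
  by rewrite mevalXU.
- by apply: (nz 1); rewrite mevalM !mevalXU mulr1 oner_eq0.
- apply: (nz 2); rewrite mevalB rmorphXn /= mevalXU.
  by rewrite expr2 mulr_natl mulr2n addrK pnatr_eq0.
Qed.

Lemma finite_mode_identity :
  finite_set [set q : {mpoly R[N + n]} | mode_identity q].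
Proof.
apply: (@sub_finite_set _ _ ([set \sum_(i < N) bvar i - 1]
  `|` ((fun ij : 'I_N * 'I_N => bvar ij.1 * bvar ij.2) @` setT)
  `|` ((fun i : 'I_N => bvar i ^+ 2 - bvar i) @` setT))).
  move=> q [|i j _|i]; [by left; left | left; right | by right; exists i].
  by exists (i, j).
rewrite !finite_setU; split; last exact: finite_image.
by split; [exact: finite_set1 | exact: finite_image].
Qed.

(** The rows of [C X + D Xbar = 0] have to enumerate all the relations among
    the listed moments, although the monomial multiplier [mu] is unrestricted.
    Since the identity [q] is a nonzero polynomial, some monomial of its product
    with [mu] is a multiple of [mu]; that monomial is listed, so the degree of
    [mu] is at most the largest listed degree, and finitely many products
    remain. *)
Lemma finite_algebraic_relation (ms : seq (multinom (N + n))) :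
  finite_set (algebraic_relation (R := R) ms).
Proof.
pose b := (\max_(m <- ms) mdeg m)%N.
apply: (@sub_finite_set _ _ ((fun qm : {mpoly R[N + n]} * multinom (N + n) =>
    qm.1 * mpolyX R qm.2) @` ([set q | mode_identity q] `*`
    ((fun m : bmultinom (N + n) b.+1 => bmnm m) @` setT)))); last first.
  apply/finite_image/finite_setX; first exact: finite_mode_identity.
  exact: finite_image.
move=> _ [[q q0 [mu ->]] sub]; exists (q, mu) => //=; split => //.
suff mu_lt : (mdeg mu < b.+1)%N by exists (BMultinom mu_lt).
have [m mq] : exists m, m \in msupp q.
  have := mode_identity_neq0 q0; rewrite -msupp_eq0.
  by case: (msupp q) => // m s _; exists m; rewrite mem_head.
rewrite ltnS (leq_trans (leq_addl (mdeg m) _))// -mdegD.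
apply: leq_bigmax_seq => //; apply: sub.
by rewrite mcoeff_msupp addmC mcoeffMX -mcoeff_msupp.
Qed.

End ModeIdentities.

(** * The single-mode system *)

Section SingleModeSystem.
Context {R : realType} {N n : nat}.

Lemma poly_mx_fun_usubmx : poly_mx_fun (fun z : 'cV[R]_(N + n) => usubmx z).
Proof.
move=> i j; rewrite ord1; under [X in poly_fun X]eq_fun do rewrite mxE.
exact: poly_fun_coord.
Qed.

Lemma poly_mx_fun_dsubmx : poly_mx_fun (fun z : 'cV[R]_(N + n) => dsubmx z).
Proof.
move=> i j; rewrite ord1; under [X in poly_fun X]eq_fun do rewrite mxE.
exact: poly_fun_coord.
Qed.

Lemma poly_fun_mode_sum (h : 'I_N -> 'cV[R]_n -> R) :
  (forall i, poly_fun (h i)) ->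
  poly_fun
    (fun z : 'cV[R]_(N + n) => \sum_(i < N) usubmx z i 0 * h i (dsubmx z)).
Proof.
move=> hp; apply: poly_fun_sum => i; apply: poly_funM.
  exact: (poly_mx_fun_usubmx i 0).
exact: poly_fun_comp poly_mx_fun_dsubmx.
Qed.

Lemma poly_mx_fun_mode_sum a c (h : 'I_N -> 'cV[R]_n -> 'M[R]_(a, c)) :
  (forall i, poly_mx_fun (h i)) ->
  poly_mx_fun
    (fun z : 'cV[R]_(N + n) => \sum_(i < N) usubmx z i 0 *: h i (dsubmx z)).
Proof.
move=> hp; apply: poly_mx_fun_sum => i; apply: poly_mx_funZ.
  exact: (poly_mx_fun_usubmx i 0).
exact: poly_mx_fun_comp poly_mx_fun_dsubmx.
Qed.

Lemma poly_fun_sm_generator k r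
    (f : 'I_N -> 'cV[R]_n -> 'cV[R]_n)
    (g : 'I_N -> 'cV[R]_n -> 'M[R]_(n, k))
    (lambda : 'I_r -> 'I_N -> 'cV[R]_n -> R)
    (theta : 'I_r -> 'I_N -> 'I_N)
    (phi : 'I_r -> 'I_N -> 'cV[R]_n -> 'cV[R]_n) (m : multinom (N + n)) :
  (forall i, poly_mx_fun (f i)) -> (forall i, poly_mx_fun (g i)) ->
  (forall l i, poly_fun (lambda l i)) ->
  (forall l i, poly_mx_fun (phi l i)) ->
  poly_fun (generator (sm_drift f) (sm_diffusion g) (sm_intensity lambda)
                      (sm_reset theta phi) (monomial m)).
Proof.
move=> fp gp lp pp; apply: poly_fun_generator.
- apply: poly_mx_fun_col; first exact: poly_mx_fun_cst.
  exact: poly_mx_fun_mode_sum.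
- apply: poly_mx_fun_col; first exact: poly_mx_fun_cst.
  exact: poly_mx_fun_mode_sum.
- by move=> l; apply: poly_fun_mode_sum.
- move=> l; apply: poly_mx_fun_col; last exact: poly_mx_fun_mode_sum.
  (* The subtracted sum in the [b] part of the reset is the case [e = id], the
     added one the case [e = theta l]. *)
  have ep (e : 'I_N -> 'I_N) : poly_mx_fun
      (fun z : 'cV[R]_(N + n) =>
         \sum_(i < N) usubmx z i 0 *: @mode_vector R N (e i)).
    apply: (@poly_mx_fun_mode_sum _ _ (fun i _ => mode_vector (e i))) => i.
    exact: poly_mx_fun_cst.
  apply: poly_mx_funD; last exact: ep.
  apply: poly_mx_funB; last exact: (ep id).
  exact: poly_mx_fun_usubmx.
Qed.

End SingleModeSystem.

Theorem theorem1 (R : realType) (N n k r : nat)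
    (f : 'I_N -> 'cV[R]_n -> 'cV[R]_n)
    (g : 'I_N -> 'cV[R]_n -> 'M[R]_(n, k))
    (lambda : 'I_r -> 'I_N -> 'cV[R]_n -> R)
    (theta : 'I_r -> 'I_N -> 'I_N)
    (phi : 'I_r -> 'I_N -> 'cV[R]_n -> 'cV[R]_n)
    (lambda_ge0 : forall l i x, 0 <= lambda l i x)
    (f_poly : forall i, poly_mx_fun (f i))
    (g_poly : forall i, poly_mx_fun (g i))
    (lambda_poly : forall l i, poly_fun (lambda l i))
    (phi_poly : forall l i, poly_mx_fun (phi l i))
    (M : nat) (X : seq (multinom (N + n)))
    (X_uniq : uniq X)
    (X_all : forall m, (m \in X) = (mdeg m <= M)%N) :
  exists (Xbar : seq (multinom (N + n))) (c : nat)
         (A : 'M[R]_(size X, size X)) (B : 'M[R]_(size X, size Xbar))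
         (C : 'M[R]_(c, size X)) (D : 'M[R]_(c, size Xbar)),
  [/\ uniq Xbar,
      (forall m, m \in Xbar -> (M < mdeg m)%N),
      encodes_mode_identities C D &
      forall (disp : measure_display) (T : measurableType disp)
        (P : probability T R)
        (q : R -> T -> 'I_N) (x : R -> T -> 'cV[R]_n)
        (Z := fun t w => joint_state (q t w) (x t w)),
      moments_evolve_by_generator P (sm_drift f) (sm_diffusion g)
        (sm_intensity lambda) (sm_reset theta phi) Z ->
      forall t, 0 <= t ->
        (forall i, has_time_derivative
           (fun s => moment_vector P (Z s) X i 0) t
           ((A *m moment_vector P (Z t) X
             + B *m moment_vector P (Z t) Xbar) i 0)) /\
        0 = C *m moment_vector P (Z t) X + D *m moment_vector P (Z t) Xbar].
Proof.
have [L LE] := choice (fun m =>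
  poly_fun_sm_generator theta m f_poly g_poly lambda_poly phi_poly).
pose Xbar :=
  undup [seq m <- flatten [seq msupp (L m) | m <- X] | (M < mdeg m)%N].
have Xbar_deg m : m \in Xbar -> (M < mdeg m)%N.
  by rewrite mem_undup mem_filter => /andP[].
have XX_uniq : uniq (X ++ Xbar).
  rewrite cat_uniq X_uniq undup_uniq andbT; apply/hasPn => m /Xbar_deg.
  by rewrite X_all -ltnNge.
have L_supp m : m \in X -> {subset msupp (L m) <= X ++ Xbar}.
  move=> mX m' m'L; rewrite mem_cat X_all; case: leqP => //= lt_m'.
  rewrite mem_undup mem_filter lt_m'; apply/flattenP.
  by exists (msupp (L m)) => //; apply: map_f.
have [rels relsE] :=
  (finite_seqP _).1 (finite_algebraic_relation (R := R) (X ++ Xbar)).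
have relsP p : p \in rels <-> algebraic_relation (X ++ Xbar) p by rewrite relsE.
exists Xbar, (size rels),
  (\matrix_i coeff_row (L (tnth (in_tuple X) i)) X),
  (\matrix_i coeff_row (L (tnth (in_tuple X) i)) Xbar),
  (\matrix_l coeff_row (tnth (in_tuple rels) l) X),
  (\matrix_l coeff_row (tnth (in_tuple rels) l) Xbar).
split => //; first exact: undup_uniq.
  split=> [l|p /relsP /(tnthP (in_tuple rels))[l ->]]; last first.
    by exists l; rewrite !rowK.
  exists (tnth (in_tuple rels) l); last by rewrite !rowK.
  exact/relsP/mem_tnth.
move=> disp T P q x Z Zev t t_ge0; have [Zfin Zder] := Zev t t_ge0.
have rowsE c (p : 'I_c -> {mpoly R[N + n]}) (i : 'I_c) :
    {subset msupp (p i) <= X ++ Xbar} ->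
    ((\matrix_l coeff_row (p l) X) *m moment_vector P (Z t) X
     + (\matrix_l coeff_row (p l) Xbar) *m moment_vector P (Z t) Xbar) i 0
    = fine 'E_P[fun w => meval (fun j => Z t w j 0) (p i)].
  move=> sub; rewrite (expectation_meval Zfin XX_uniq sub) big_cat mxE.
  by rewrite !coeff_rows_moment_vector.
split=> [i|].
  rewrite (rowsE _ (fun i => L (tnth (in_tuple X) i))); last first.
    by apply: L_supp; apply: mem_tnth.
  under eq_fun do rewrite mxE.
  under [X in fine 'E_P[X]]eq_fun do rewrite -LE.
  exact: Zder.
apply/matrixP => l j; rewrite ord1 (rowsE _ (fun l => tnth (in_tuple rels) l)).
  have /relsP[[s s0 [mu ->]] _] := mem_tnth l (in_tuple rels).
  under [X in fine 'E_P[X]]eq_fun do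
    rewrite mevalM (mode_identity_joint_state _ _ s0) mul0r.
  by rewrite expectation_cst mxE.
by have /relsP[] := mem_tnth l (in_tuple rels).
Qed.
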